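(* Let $S\subset T\subset\mathbb{R}^2$, with $|S|=2$ and $|T|=4$. Then $V_T(S)$ is not a triangle.
   Context: For a finite nonempty set $T\subset\mathbb{R}^n$ and a nonempty proper subset $S\subset T$, the multipoint (higher order) Voronoi cell is $$V_T(S):=\left\{x\in\mathbb{R}^n : \max_{s\in S}\|x-s\|\le\min_{t\in T\setminus S}\|x-t\|\right\},$$ where $\|\cdot\|$ is the Euclidean norm. A triangle is the convex hull of three affinely independent points. *)

(* Defs.v *)
From mathcomp Require Import all_boot all_order all_algebra finmap.
From mathcomp Require Import all_classical all_reals all_analysis.

Set Implicit Arguments.
Unset Strict Implicit.
Unset Printing Implicit Defensive.

Import Order.TTheory GRing.Theory Num.Theory.

Local Open Scope classical_set_scope.
Local Open Scope ring_scope.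

(* The canonical norm `|x| on 'rV[R]_n is the sup norm, not the Euclidean one. *)
Definition enorm (R : realType) (n : nat) (x : 'rV[R]_n) : R :=
  Num.sqrt (\sum_(i < n) x ord0 i ^+ 2).

(* For a nonempty proper subset S of T, the sup and the inf below are taken
   over nonempty finite sets, so they are the max over S and the min over
   T \ S; sup and inf are 0 on the empty set, hence the definition is only
   meaningful under that assumption. *)
Definition voronoi_cell (R : realType) (n : nat) (T S : {fset 'rV[R]_n}) :
    set 'rV[R]_n :=
  [set x | sup [set enorm (x - s) | s in [set` S]] <=
           inf [set enorm (x - t) | t in [set` (T `\` S)%fset]]].

Definition convex_hull (R : realType) (n : nat) (A : set 'rV[R]_n) :
    set 'rV[R]_n :=
  smallest (fun C : set 'rV[R]_n => convex_set (C : set (convex_lmodType 'rV[R]_n))) A.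

Definition affinely_independent (R : realType) (n k : nat)
    (p : 'I_k -> 'rV[R]_n) : Prop :=
  forall c : 'I_k -> R,
    \sum_i c i = 0 -> \sum_i c i *: p i = 0 -> forall i, c i = 0.

Definition is_triangle (R : realType) (n : nat) (A : set 'rV[R]_n) : Prop :=
  exists2 p : 'I_3 -> 'rV[R]_n,
    affinely_independent p & A = convex_hull (range p).

(* Main.v *)
Require Import Defs.
From mathcomp Require Import all_boot all_order all_algebra finmap.
From mathcomp Require Import all_classical all_reals all_analysis.
From mathcomp Require Import ring lra.

(** Writing $S = \{s_0, s_1\}$ and $T \setminus S = \{t_0, t_1\}$, the cell is
    the set where the four affine functions
    $f_{ij}(x) = |x - t_j|^2 - |x - s_i|^2$ are nonnegative, and
    $f_{00} + f_{11} = f_{01} + f_{10}$. If it were a triangle, each of its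
    three sides would lie on the zero line of some $f_{ij}$ that is positive at
    the opposite vertex. Three distinct indices out of the four contain an
    opposite pair, so two of the sides belong, say, to $f_{00}$ and $f_{11}$.
    At their common vertex $f_{01} + f_{10} = 0$, so all four functions vanish
    there and none can be positive, as the third side requires. *)

Set Implicit Arguments.
Unset Strict Implicit.
Unset Printing Implicit Defensive.

Import Order.TTheory GRing.Theory Num.Theory.
Local Open Scope classical_set_scope.
Local Open Scope ring_scope.

Section ConvexHull.
Variables (R : realType) (n k : nat) (p : 'I_k -> 'rV[R]_n).

Lemma convex_hull_vertex (i : 'I_k) : convex_hull (range p) (p i).
Proof. by apply: sub_gen_smallest; exists i. Qed.

Lemma convex_hull_range_comb (x : 'rV[R]_n) : convex_hull (range p) x ->
  exists2 c : 'I_k -> R, (forall i, 0 <= c i) /\ \sum_i c i = 1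
    & x = \sum_i c i *: p i.
Proof.
pose C := [set x | exists2 c : 'I_k -> R,
  (forall i, 0 <= c i) /\ \sum_i c i = 1 & x = \sum_i c i *: p i].
apply: (@smallest_sub _ _ _ C) => [|_ [i _ <-]].
  apply/convex_setW => y z /set_mem; rewrite /C /=.
  move=> [c [c0 c1] ->] /set_mem[d [d0 d1] ->] l l0 l1; apply/mem_set => /=.
  exists (fun i => l%:num * c i + (1 - l%:num) * d i); first split.
  - move=> i; apply: addr_ge0; apply: mulr_ge0 => //;
      rewrite ?subr_ge0 ltW.
  - by rewrite big_split/= -!mulr_sumr c1 d1 !mulr1 addrC subrK.
  - under [RHS]eq_bigr do rewrite scalerDl -!scalerA.
    by rewrite big_split/= -!scaler_sumr.
exists (fun j => (j == i)%:R); first split => //.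
  by rewrite (bigD1 i)//= eqxx big1 ?addr0// => j /negPf ->.
by rewrite (bigD1 i)//= eqxx scale1r big1 ?addr0// => j /negPf ->; rewrite scale0r.
Qed.

(** Affine independence makes coefficients of sum 1 unique, so [c] agrees with the nonnegative ones
    that hull membership provides. *)
Lemma convex_hull_coord_ge0 (c : 'I_k -> R) : affinely_independent p ->
  \sum_i c i = 1 -> convex_hull (range p) (\sum_i c i *: p i) ->
  forall i, 0 <= c i.
Proof.
move=> p_indep c1 /convex_hull_range_comb[d [d0 d1] cd] i.
rewrite -[c i](subrK (d i)) (p_indep (fun j => c j - d j)) ?add0r//.
  by rewrite sumrB c1 d1 subrr.
under eq_bigr do rewrite scalerBl.
by rewrite sumrB cd subrr.
Qed.

End ConvexHull.

Lemma small_scaling (R : realFieldType) (I : finType) (u v : I -> R) :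
  (forall a, 0 <= v a) -> (forall a, 0 < u a -> 0 < v a) ->
  exists2 e : R, 0 < e & forall a, e * u a <= v a.
Proof.
(* Only indices with [0 < u a] constrain [e]; the default 1 keeps it positive if there are none. *)
move=> v0 uv; pose e := \big[Num.min/1]_(a | 0 < u a) (v a / u a).
have e0 : 0 < e by apply: lt_bigmin => // a ua; rewrite divr_gt0// uv.
exists e => // a; have [ua|ua] := ltP 0 (u a).
  by rewrite -ler_pdivlMr//; exact: bigmin_le_cond.
by apply: le_trans (v0 a); rewrite pmulr_rle0.
Qed.

(** The coefficients may be negative: [simplex_facet] evaluates such functions outside the
    simplex. *)
Definition affine_fun (R : realType) (n : nat) (f : 'rV[R]_n -> R) :=
  forall (k : nat) (c : 'I_k -> R) (p : 'I_k -> 'rV[R]_n), \sum_i c i = 1 ->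
    f (\sum_i c i *: p i) = \sum_i c i * f (p i).

(** Otherwise each constraint positive at [p i] is also positive at the barycenter of the opposite
    facet. That barycenter can then be pushed slightly outwards with all constraints kept, which
    gives a point of the hull with a negative coordinate at [p i]. *)
Lemma simplex_facet (R : realType) (n k : nat) (I : finType)
    (f : I -> 'rV[R]_n -> R) (p : 'I_k.+2 -> 'rV[R]_n) :
  (forall a, affine_fun (f a)) -> affinely_independent p ->
  [set x | forall a, 0 <= f a x] = convex_hull (range p) ->
  forall i, exists2 a, 0 < f a (p i) & forall j, j != i -> f a (p j) = 0.
Proof.
move=> f_aff p_indep hullE i; apply: contrapT => no_facet.
have fp_ge0 a j : 0 <= f a (p j).
  by have := @convex_hull_vertex _ _ _ p j; rewrite -hullE; exact.
(* By affinity, [m a] is the value of [f a] at the barycenter of the facet opposite [p i]. *)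
pose m a := k.+1%:R^-1 * \sum_(j < k.+2 | j != i) f a (p j).
have m0 a : 0 <= m a by rewrite mulr_ge0 ?invr_ge0// sumr_ge0.
have m_gt0 a : 0 < f a (p i) -> 0 < m a.
  move=> fi; rewrite lt_neqAle m0 andbT eq_sym mulf_eq0 invr_eq0 pnatr_eq0/=.
  apply/negP => /eqP /psumr_eq0P f0; apply: no_facet; exists a => // j ji.
  by apply: f0.
have [e e0 em] := small_scaling m0 m_gt0.
(* Move from the barycenter of the opposite facet away from [p i]. *)
pose c j := if j == i then - e else (1 + e) / k.+1%:R.
have sum_c (V : lmodType R) (F : 'I_k.+2 -> V) : \sum_j c j *: F j =
    - e *: F i + ((1 + e) / k.+1%:R) *: \sum_(j < k.+2 | j != i) F j.
  rewrite (bigD1 i)//= /c eqxx scaler_sumr; congr (_ + _).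
  by apply: eq_bigr => j /negPf ->.
have c1 : \sum_j c j = 1.
  have -> : \sum_j c j = - e * 1 + (1 + e) / k.+1%:R * \sum_(j < k.+2 | j != i) 1.
    by rewrite -(sum_c R^o); apply: eq_bigr => j _; rewrite [RHS]mulr1.
  rewrite sumr_const cardC1 card_ord /= divfK ?pnatr_eq0//; ring.
have : [set x | forall a, 0 <= f a x] (\sum_j c j *: p j).
  move=> a; rewrite f_aff//.
  have -> : \sum_j c j * f a (p j) = - e * f a (p i) + (1 + e) * m a.
    by rewrite /m mulrA; exact: (sum_c R^o).
  have := em a; have := mulr_ge0 (ltW e0) (m0 a); lra.
rewrite hullE => /(convex_hull_coord_ge0 p_indep c1)/(_ i).
by rewrite /c eqxx oppr_ge0 leNgt e0.
Qed.

Section Voronoi.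
Variables (R : realType) (n : nat).

Definition sqnorm (x : 'rV[R]_n) : R := \sum_(i < n) x ord0 i ^+ 2.

Lemma ler_enorm (x y : 'rV[R]_n) : (enorm x <= enorm y) = (sqnorm x <= sqnorm y).
Proof.
by rewrite /enorm ler_sqrt//; apply: sumr_ge0 => i _; exact: sqr_ge0.
Qed.

Definition gap (s t x : 'rV[R]_n) : R := sqnorm (x - t) - sqnorm (x - s).

(** The squares of the coordinates of [x] cancel, which is why [gap] is affine in [x]. *)
Lemma gapE (s t x : 'rV[R]_n) :
  gap s t x = sqnorm t - sqnorm s - \sum_(i < n) x ord0 i * (2 * (t - s) ord0 i).
Proof.
rewrite /gap /sqnorm -!sumrB; apply: eq_bigr => i _; rewrite !mxE; ring.
Qed.

Lemma gap_affine (s t : 'rV[R]_n) : affine_fun (gap s t).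
Proof.
move=> k c p c1; rewrite gapE; under [RHS]eq_bigr do rewrite gapE mulrBr.
rewrite sumrB -mulr_suml c1 mul1r; congr (_ - _).
under [RHS]eq_bigr do rewrite mulr_sumr; rewrite exchange_big/=.
apply: eq_bigr => i _; rewrite summxE mulr_suml; apply: eq_bigr => j _.
by rewrite [(c j *: p j) _ _]mxE -mulrA.
Qed.

Lemma voronoi_cell2 (T S : {fset 'rV[R]_n}) (s t : bool -> 'rV[R]_n) :
  S = [fset s false; s true]%fset -> (T `\` S)%fset = [fset t false; t true]%fset ->
  voronoi_cell T S = [set x | forall a : bool * bool, 0 <= gap (s a.1) (t a.2) x].
Proof.
move=> ES ET.
have inS b : s b \in S by rewrite ES !inE; case: b; rewrite eqxx ?orbT.
have inT b : t b \in (T `\` S)%fset by rewrite ET !inE; case: b; rewrite eqxx ?orbT.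
have SP y : y \in S -> exists b, y = s b.
  by rewrite ES !inE => /orP[] /eqP ->; [exists false|exists true].
have TP y : y \in (T `\` S)%fset -> exists b, y = t b.
  by rewrite ET !inE => /orP[] /eqP ->; [exists false|exists true].
apply/seteqP; split => x /=.
  move=> cell [i j]; rewrite /gap subr_ge0 -ler_enorm /=.
  apply: le_trans (le_trans cell _).
    apply: ub_le_sup; last by exists (s i) => //=; exact: inS.
    (* Any upper bound will do; the sum of the two norms avoids comparing them. *)
    exists (enorm (x - s false) + enorm (x - s true)) => _ [y /SP[b ->] <-].
    by case: b; rewrite ?lerDl ?lerDr sqrtr_ge0.
  apply: ge_inf; last by exists (t j) => //=; exact: inT.
  by exists 0 => _ [y _ <-]; exact: sqrtr_ge0.
move=> gap_ge0; apply: ge_sup => [|_ [y /SP[i ->] <-]].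
  by exists (enorm (x - s true)), (s true) => //; exact: inS.
apply: lb_le_inf => [|_ [z /TP[j ->] <-]].
  by exists (enorm (x - t true)), (t true) => //; exact: inT.
by rewrite ler_enorm -subr_ge0; exact: (gap_ge0 (i, j)).
Qed.

End Voronoi.

Lemma fset_card2 (K : choiceType) (A : {fset K}) : #|` A|%fset = 2%N ->
  exists s : bool -> K, A = [fset s false; s true]%fset.
Proof.
move=> A2; have [x xA] : exists x, x \in A by apply/fset0Pn; rewrite -cardfs_gt0 A2.
have /eqP/cardfs1P[y Ay] : #|` (A `\ x)%fset|%fset = 1%N.
  by have := cardfsD1 x A; rewrite xA A2 => -[].
by exists (fun b => if b then y else x); rewrite -Ay fsetD1K.
Qed.

(** Pigeonhole on the parity [q]: two of the three pairs share it, and pairs of equal parity are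
    equal or opposite. The third index is [l]. *)
Lemma three_pairs_opposite (e : 'I_3 -> bool * bool) :
  exists i j l, [/\ i != j, i != l, j != l
    & (e j = e i) \/ (e j = (~~ (e i).1, ~~ (e i).2))].
Proof.
pose q l := (e l).1 (+) (e l).2.
have same i j : q i = q j ->
    e j = e i \/ e j = (~~ (e i).1, ~~ (e i).2).
  by rewrite /q; case: (e i) (e j) => [[] []] [[] []] //= _; by [left | right].
have [q01|q01] := eqVneq (q ord0) (q (inord 1)).
  exists ord0, (inord 1), (inord 2); split; last exact: same.
  1-3: by rewrite -val_eqE /= !inordK.
have [q02|q02] := eqVneq (q ord0) (q (inord 2)).
  exists ord0, (inord 2), (inord 1); split; last exact: same.
  1-3: by rewrite -val_eqE /= !inordK.
exists (inord 1), (inord 2), ord0; split.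
1-3: by rewrite -val_eqE /= !inordK.
apply: same; move: q01 q02; by do 3 case: (q _).
Qed.

Theorem proposition3p3 (R : realType) (T S : {fset 'rV[R]_2}) :
  (S `<=` T)%fset -> #|` S|%fset = 2%N -> #|` T|%fset = 4%N ->
  ~ is_triangle (voronoi_cell T S).
Proof.
move=> ST S2 T4 [p p_indep].
have [s Es] := fset_card2 S2.
have [t Et] : exists t : bool -> 'rV[R]_2, (T `\` S)%fset = [fset t false; t true]%fset.
  by apply: fset_card2; rewrite cardfsDS// S2 T4.
rewrite (voronoi_cell2 Es Et) => cellE.
pose f (a : bool * bool) := gap (s a.1) (t a.2).
have f_aff a : affine_fun (f a) by exact: gap_affine.
have f_ge0 a i : 0 <= f a (p i).
  by have := @convex_hull_vertex _ _ _ p i; rewrite -cellE; exact.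
(* Each of the four points contributes its squared distance to [x] exactly once on either side. *)
have f_opp a x : f a x + f (~~ a.1, ~~ a.2) x = f (~~ a.1, a.2) x + f (a.1, ~~ a.2) x.
  rewrite /f /gap /=; ring.
have facet i : {a | 0 < f a (p i) & forall j, j != i -> f a (p j) = 0}.
  exact/cid2/(simplex_facet f_aff p_indep cellE i).
pose e i := s2val (facet i).
have e_gt0 i : 0 < f (e i) (p i) by exact: s2valP (facet i).
have e_eq0 i j : j != i -> f (e i) (p j) = 0 by apply: (s2valP' (facet i)).
have [i [j [l [ij il jl [eij|eij]]]]] := three_pairs_opposite e.
  (* Equal pairs are impossible: the function of side [j] vanishes at [p i], that of side [i] does
     not. *)
  by have := e_gt0 i; rewrite -eij e_eq0// ltxx.
have fi0 : f (e i) (p l) = 0 by apply: e_eq0; rewrite eq_sym.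
have fj0 : f (e j) (p l) = 0 by apply: e_eq0; rewrite eq_sym.
have := f_opp (e i) (p l); rewrite -eij fi0 fj0 addr0 => /esym/eqP.
rewrite paddr_eq0// => /andP[/eqP f1 /eqP f2].
have := e_gt0 l; move: fi0 fj0 f1 f2; rewrite eij.
by case: (e i) (e l) => [[] []] [[] []] /= f00 f11 f01 f10;
  rewrite (f00, f11, f01, f10) ltxx.
Qed.
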